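(* Let $M\ge 1$ be an integer. For every real $q>1$, the limit $$h(\mathcal U_q'):=\lim_{n\to\infty}\frac{\log |B_n(\mathcal U_q')|}{n}$$ exists and is equal to $\inf_{n\ge 1}\frac{\log |B_n(\mathcal U_q')|}{n}$, and $$\dim_H\mathcal U_q=\frac{h(\mathcal U_q')}{\log q}.$$
   Context: Sequences are elements $c=(c_i)_{i\ge1}$ of $\{0,1,\ldots,M\}^{\infty}$. For a real base $q>1$, an expansion of a real number $x$ in base $q$ is a sequence $(c_i)\in\{0,\ldots,M\}^\infty$ with $\sum_{i=1}^\infty c_i q^{-i}=x$. $\mathcal U_q$ is the set of real numbers $x$ having exactly one expansion in base $q$, and $\mathcal U_q'\subseteq\{0,\ldots,M\}^\infty$ is the set of the corresponding expansions. $B_n(\mathcal U_q')$ is the set of different initial words $c_1\cdots c_n$ of length $n$ of sequences $(c_i)\in\mathcal U_q'$, and $|\cdot|$ denotes cardinality. $\dim_H$ is Hausdorff dimension in $\mathbb R$. Logarithms are in base two. *)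

(* Defs.v *)
From HB Require Import structures.
From mathcomp Require Import all_boot all_order all_algebra.
From mathcomp Require Import all_classical all_reals all_analysis.
Set Implicit Arguments.
Unset Strict Implicit.
Unset Printing Implicit Defensive.
Import Order.TTheory GRing.Theory Num.Theory.
Import numFieldNormedType.Exports.
Local Open Scope classical_set_scope.
Local Open Scope ring_scope.

Definition log2 {R : realType} (x : R) : R := ln x / ln 2.

(* Digit sequences are indexed from 0: [c i] is the digit c_{i+1}, of weight
   q^-(i+1). *)
Definition digit_seq (M : nat) := nat -> 'I_M.+1.

Definition is_expansion {R : realType} {M : nat} (q : R) (c : digit_seq M)
    (x : R) : Prop :=
  [series (c i)%:R / q ^+ i.+1]_i @ \oo --> x.

Definition univoque {R : realType} (M : nat) (q : R) : set R :=
  [set x | exists! c : digit_seq M, is_expansion q c x].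

Definition univoque_seq {R : realType} (M : nat) (q : R) : set (digit_seq M) :=
  [set c | exists2 x, univoque M q x & is_expansion q c x].

Arguments univoque {R} M q _.
Arguments univoque_seq {R} M q _.

Definition initial_words {M : nat} (n : nat) (X : set (digit_seq M)) :
    {set n.-tuple 'I_M.+1} :=
  [set w | `[< exists2 c, X c & forall i : 'I_n, tnth w i = c i >]]%SET.

(* The value at n = 0 is the junk value 0. *)
Definition word_growth (R : realType) {M : nat} (X : set (digit_seq M))
    (n : nat) : R :=
  log2 (#|initial_words n X|%:R) / n%:R.

Arguments word_growth R {M} X n.

Definition entropy (R : realType) {M : nat} (X : set (digit_seq M)) : R :=
  limn (word_growth R X).

Section Hausdorff.
Local Open Scope ereal_scope.
Context {R : realType}.
Implicit Types (A : set R) (s delta : R).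

(* Equal to -oo on the empty set. *)
Definition diam A : \bar R :=
  ereal_sup [set (`|x - y|%R)%:E | x in A & y in A].

(* diam(A)^s, with 0^0 = 1 for a singleton; the empty set has gauge 0 even
   when s = 0. *)
Definition diam_pow s A : \bar R :=
  if `[< A = set0 >] then 0 else poweR (diam A) s.

Definition hausdorff_premeasure s delta A : \bar R :=
  ereal_inf [set \sum_(0 <= i <oo) diam_pow s (F i) | F in
    [set F : nat -> set R | A `<=` \bigcup_i F i /\
                            forall i, diam (F i) <= delta%:E]].

(* The limit as delta -> 0+, which is a supremum by monotonicity. *)
Definition hausdorff_measure s A : \bar R :=
  ereal_sup [set hausdorff_premeasure s delta A | delta in
    [set delta | (0 < delta)%R]].

Definition hausdorff_dim A : \bar R :=
  ereal_inf [set s%:E | s in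
    [set s | (0 <= s)%R /\ hausdorff_measure s A = 0]].

End Hausdorff.

(* Main.v *)
(** Let A = M/(q-1) be the largest value of a digit sequence. A sequence c is
    univoque iff no digit can be changed, i.e. for every n the value v of the
    tail after c_n satisfies v < 1 if c_n < M and v > A - 1 if c_n > 0. The
    limit exists by Fekete's lemma, as univoque sequences are stable under
    shifts, and covering by cylinders bounds the dimension from above.

    For the lower bound, relax both inequalities to non-strict ones. The
    sequences so obtained contain the closure of the univoque sequences, their
    values are univoque up to a countable set, and two of them which differ
    within the first n digits have values at distance at least |A - 1| / q^n.
    If A <> 1, a cover of the univoque set with small sum of diam^s therefore
    yields, by compactness, finitely many cylinders of lengths m_i with
    sum_i q^(-s m_i) < 1 that contain all univoque sequences. Cutting off a
    first block gives |B_k| <= sum_i |B_(k - m_i)|, hence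
    |B_k| = O(q^(s k)), as in Furstenberg's theorem on closed invariant sets.
    If A = 1, i.e. q = M + 1, the univoque set is [0, 1] up to a countable set,
    and Lebesgue measure gives dimension at least 1. *)

Require Import Defs.
From HB Require Import structures.
From mathcomp Require Import all_boot all_order all_algebra.
From mathcomp Require Import ring lra.
From mathcomp Require Import all_classical all_reals all_analysis.
Set Implicit Arguments.
Unset Strict Implicit.
Unset Printing Implicit Defensive.
Import Order.TTheory GRing.Theory Num.Theory.
Import numFieldNormedType.Exports.
Local Open Scope classical_set_scope.
Local Open Scope ring_scope.

(** * Shifts, prefixes and closures of digit sequences *)

Definition seq_shift {M : nat} (n : nat) (c : digit_seq M) : digit_seq M :=
  fun i => c (n + i)%N.

Definition agree {M : nat} (n : nat) (c d : digit_seq M) : Prop :=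
  forall i, (i < n)%N -> c i = d i.

Definition seq_closure {M : nat} (X : set (digit_seq M)) : set (digit_seq M) :=
  [set c | forall n, exists2 d, X d & agree n c d].

Lemma first_difference (M n : nat) (c d : digit_seq M) : ~ agree n c d ->
  exists k, [/\ (k < n)%N, agree k c d & c k != d k].
Proof.
move=> ncd.
have ex : exists k, (k < n)%N && (c k != d k).
  apply: contrapT => h; apply: ncd => i lin; apply/eqP.
  by apply: contrapT => /negP ne; apply: h; exists i; rewrite lin.
case: (ex_minnP ex) => k /andP[kn ne] kmin; exists k; split=> // i ik.
apply/eqP; apply: contraT => nei.
by have := kmin i; rewrite nei (ltn_trans ik kn) leqNgt ik => /(_ isT).
Qed.

(** * Values of digit sequences and existence of expansions in base [q] *)

Section Expansions.
Context {R : realType} {M : nat} (q : R).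
Hypothesis q_gt1 : 1 < q.
Implicit Types (c d : digit_seq M) (x : R) (n : nat).

Let q_gt0 : 0 < q. Proof. exact: lt_trans q_gt1. Qed.
Let qn_gt0 n : 0 < q ^+ n. Proof. exact: exprn_gt0. Qed.

Definition max_val : R := M%:R / (q - 1).

Definition seq_val c : R := limn [series (c i)%:R / q ^+ i.+1]_i.

Lemma max_val_ge0 : 0 <= max_val.
Proof. by rewrite divr_ge0 // subr_ge0 ltW. Qed.

Lemma max_valE : q * max_val = max_val + M%:R.
Proof. by rewrite /max_val; field; rewrite subr_eq0 gt_eqF. Qed.

Lemma max_val_eq1 : max_val = 1 -> q = M.+1%:R.
Proof. by have := max_valE; rewrite -natr1 => + A1; rewrite A1; lra. Qed.

Lemma expVn_cvg0 (a : R) : (fun n => a / q ^+ n) @ \oo --> 0.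
Proof.
rewrite [X in X @ _](_ : _ = geometric a q^-1); last first.
  by apply/funext => n /=; rewrite exprVn.
apply: cvg_geometric.
by rewrite ger0_norm ?invr_ge0 ?(ltW q_gt0)// invf_lt1.
Qed.

Lemma exists_expVn_lt (a e : R) : 0 < e -> exists n, a / q ^+ n < e.
Proof.
move=> e0; have /cvgrPdist_lt/(_ _ e0)[n _ /(_ n (leqnn n))/=] := expVn_cvg0 a.
by rewrite sub0r normrN => h; exists n; apply: le_lt_trans h; exact: ler_norm.
Qed.

Lemma digit_le c i : (c i)%:R <= M%:R :> R.
Proof. by rewrite ler_nat -ltnS. Qed.

Lemma partial_sum_split c n :
  [series (c i)%:R / q ^+ i.+1]_i n.+1 =
  ((c 0)%:R + [series (seq_shift 1 c i)%:R / q ^+ i.+1]_i n) / q :> R.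
Proof.
rewrite /series /= big_nat_recl // expr1 mulrDl mulr_suml; congr (_ + _).
by apply: eq_bigr => i _; rewrite /seq_shift add1n (exprS q i.+1) invfM mulrA mulrAC.
Qed.

Lemma partial_sum_bounds c n :
  0 <= ([series (c i)%:R / q ^+ i.+1]_i : R^nat) n <= max_val.
Proof.
elim: n c => [|n IH] c.
  by rewrite /series /= big_geq // lexx max_val_ge0.
rewrite partial_sum_split; have /andP[h0 h1] := IH (seq_shift 1 c).
rewrite divr_ge0 ?addr_ge0 ?(ltW q_gt0)//= ler_pdivrMr // mulrC max_valE addrC.
exact: lerD (digit_le _ _).
Qed.

Lemma seq_val_cvg c : is_expansion q c (seq_val c).
Proof.
apply: nondecreasing_is_cvgn.
  apply/nondecreasing_seqP => n; rewrite seriesSr lerDl.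
  by rewrite divr_ge0 // ltW.
exists max_val => _ [n _ <-].
by have /andP[] := partial_sum_bounds c n.
Qed.

Lemma is_expansionE c x : is_expansion q c x <-> seq_val c = x.
Proof.
split=> [|<-]; last exact: seq_val_cvg.
by move=> h; exact: (cvg_lim (@Rhausdorff R) h).
Qed.

Lemma seq_val_bounds c : 0 <= seq_val c <= max_val.
Proof.
have h := @seq_val_cvg c; apply/andP; split.
  by apply: limr_ge; [exact: h|near=> n; case/andP: (partial_sum_bounds c n)].
by apply: limr_le; [exact: h|near=> n; case/andP: (partial_sum_bounds c n)].
Unshelve. all: by end_near. Qed.

Lemma seq_val1 c : seq_val c = ((c 0%N)%:R + seq_val (seq_shift 1 c)) / q.
Proof.
apply/is_expansionE; rewrite /is_expansion -cvg_shiftS /=.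
under eq_fun do rewrite partial_sum_split.
by apply: cvgMl; apply: cvgD; [exact: cvg_cst|exact: seq_val_cvg].
Qed.

Lemma shiftD (m n : nat) c : seq_shift m (seq_shift n c) = seq_shift (n + m) c.
Proof. by apply/funext => i; rewrite /seq_shift addnA. Qed.

Lemma shift0 c : seq_shift 0 c = c.
Proof. by apply/funext. Qed.

Lemma seq_val_split n c :
  seq_val c = \sum_(i < n) (c i)%:R / q ^+ i.+1 + seq_val (seq_shift n c) / q ^+ n.
Proof.
elim: n => [|n IH]; first by rewrite big_ord0 add0r expr0 divr1 shift0.
rewrite big_ord_recr /= -addrA {1}IH; congr (_ + _).
rewrite seq_val1 shiftD addn1 {1}/seq_shift addn0 exprS.
by field; rewrite !gt_eqF.
Qed.

Lemma seq_val_splitS n c :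
  seq_val c = \sum_(i < n) (c i)%:R / q ^+ i.+1 +
    ((c n)%:R + seq_val (seq_shift n.+1 c)) / q ^+ n.+1.
Proof. by rewrite (seq_val_split n.+1) big_ord_recr /= mulrDl addrA. Qed.

Lemma agree_prefix n c d : agree n c d ->
  \sum_(i < n) (c i)%:R / q ^+ i.+1 = \sum_(i < n) (d i)%:R / q ^+ i.+1 :> R.
Proof. by move=> cd; apply: eq_bigr => i _; rewrite cd. Qed.

Lemma agree_dist n c d : agree n c d ->
  `|seq_val c - seq_val d| <= max_val / q ^+ n.
Proof.
move=> cd; rewrite (seq_val_split n c) (seq_val_split n d) (agree_prefix cd).
rewrite opprD addrACA subrr add0r -mulrBl normrM (gtr0_norm (_ : 0 < (q ^+ n)^-1));
  last by rewrite invr_gt0.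
rewrite ler_pM2r ?invr_gt0// ler_norml.
have /andP[] := seq_val_bounds (seq_shift n c).
by have /andP[] := seq_val_bounds (seq_shift n d); lra.
Qed.

(** The bound on [q] means [1 <= max_val], so the intervals [[a, a + max_val]] for the digits [a]
    leave no gap and cover [[0, max_val + M]], which is the range of [q * x]. *)
Lemma exists_digit x : q <= M.+1%:R -> 0 <= x <= max_val ->
  exists a : 'I_M.+1, 0 <= q * x - a%:R <= max_val.
Proof.
move=> qM /andP[x0 xA].
have A1 : 1 <= max_val.
  by rewrite ler_pdivlMr ?subr_gt0// mul1r lerBlDr natr1.
have qx0 : 0 <= q * x by rewrite mulr_ge0 // ltW.
have [small|large] := ltP (q * x) M.+1%:R.
  have lt : (Num.truncn (q * x) < M.+1)%N by rewrite truncn_lt_nat.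
  exists (Ordinal lt) => /=; have /andP[h1 h2] := truncn_itv qx0.
  by rewrite subr_ge0 h1 /=; move: h2; rewrite -natr1; lra.
exists ord_max => /=; rewrite -natr1 in large.
have : q * x <= q * max_val by rewrite ler_pM2l.
by rewrite max_valE; lra.
Qed.

(** The remainder map [y -> q * y - f y] preserves [[0, max_val]], so the error [r n / q ^+ n] left
    after [n] digits tends to 0. *)
Lemma exists_expansion x : q <= M.+1%:R -> 0 <= x <= max_val ->
  exists c, seq_val c = x.
Proof.
move=> qM xb.
have /choice[f fP] (y : R) : exists a : 'I_M.+1,
    0 <= y <= max_val -> 0 <= q * y - a%:R <= max_val.
  have [/(exists_digit qM)[a aP]|n] := pselect (0 <= y <= max_val).
    by exists a.
  by exists ord0.
pose r n := iter n (fun y => q * y - (f y)%:R) x.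
have rb n : 0 <= r n <= max_val by elim: n => //= n; exact: fP.
pose c : digit_seq M := fun n => f (r n); exists c.
have rE n : [series (c i)%:R / q ^+ i.+1]_i n = x - r n / q ^+ n.
  elim: n => [|n IH]; first by rewrite /series /= big_geq // expr0 divr1 subrr.
  rewrite seriesSr IH /= -/(r n) /c exprS.
  by field; rewrite !gt_eqF.
apply/is_expansionE; rewrite /is_expansion (funext rE).
rewrite -[X in _ --> X]subr0; apply: cvgB; first exact: cvg_cst.
apply: (@squeeze_cvgr _ _ _ _ (fun=> 0) (fun n => max_val / q ^+ n)).
- near=> n; have /andP[h0 h1] := rb n.
  by rewrite divr_ge0 ?(ltW (qn_gt0 n))//= ler_pM2r ?invr_gt0.
- exact: cvg_cst.
- exact: expVn_cvg0.
Unshelve. all: by end_near. Qed.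

(** * Univoque and admissible sequences *)

(* No digit of c can be raised (first clause) or lowered (second clause). *)
Definition strict_admissible c := forall n,
  ((c n < M)%N -> seq_val (seq_shift n.+1 c) < 1) /\
  ((0 < c n)%N -> max_val - 1 < seq_val (seq_shift n.+1 c)).

Definition admissible c := forall n,
  ((c n < M)%N -> seq_val (seq_shift n.+1 c) <= 1) /\
  ((0 < c n)%N -> max_val - 1 <= seq_val (seq_shift n.+1 c)).

(** Replacing everything from position [n] on by [a] followed by [e] gives an expansion [d] of the
    same number, so uniqueness forces [d = c]. *)
Lemma univoque_seq_digit c n (a : 'I_M.+1) (e : digit_seq M) :
  univoque_seq M q c ->
  a%:R + seq_val e = (c n)%:R + seq_val (seq_shift n.+1 c) -> a = c n.
Proof.
move=> [x [c' [_ uniq]] cx] ae.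
pose d : digit_seq M :=
  fun i => if (i < n)%N then c i else if i == n then a else e (i - n.+1)%N.
have dc : d = c.
  rewrite -(uniq _ cx) (uniq d) //.
  apply/is_expansionE; move/is_expansionE : cx => <-.
  rewrite (seq_val_splitS n d) (seq_val_splitS n c).
  have -> : seq_shift n.+1 d = e.
    apply/funext => i; rewrite /seq_shift /d ltnNge ltnW ?ltnS ?leq_addr//=.
    by rewrite gtn_eqF ?ltnS ?leq_addr// addKn.
  rewrite {2}/d ltnn eqxx ae; congr (_ + _).
  by apply: eq_bigr => i _; rewrite /d ltn_ord.
by rewrite -[in RHS]dc /d ltnn eqxx.
Qed.

(** If a condition fails at [n], the digit can be moved by one and the tail value moved by one the
    other way stays in [[0, max_val]], hence has an expansion. Conversely, at the first difference
    of two expansions the digits are at least 1 apart, and the strict bounds keep the tails from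
    making up for it. *)
Lemma univoque_seqP c : univoque_seq M q c <-> strict_admissible c.
Proof.
split=> [uc n|sc]; last first.
  exists (seq_val c); last exact: seq_val_cvg.
  exists c; split=> [|d /is_expansionE dc]; first exact: seq_val_cvg.
  apply: contrapT => cd.
  have [k [_ agk nek]] : exists k, [/\ (k < k.+1)%N, agree k c d & c k != d k].
    have [n] : exists n, ~ agree n c d.
      apply: contrapT => h; apply: cd; apply/funext => i.
      apply: contrapT => ne; apply: h; exists i.+1 => ag; apply: ne.
      exact: ag.
    by move=> /first_difference[k [_ ? ?]]; exists k.
  have : (c k)%:R + seq_val (seq_shift k.+1 c) = (d k)%:R + seq_val (seq_shift k.+1 d).
    move: dc; rewrite (seq_val_splitS k c) (seq_val_splitS k d) (agree_prefix agk).
    by move/addrI/(@mulIf _ _ (invr_neq0 (lt0r_neq0 (qn_gt0 k.+1)))).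
  have /andP[d0 dA] := seq_val_bounds (seq_shift k.+1 d).
  have [s1 s2] := sc k.
  move: nek; rewrite -val_eqE /= neq_ltn => /orP[lt|lt].
    have := s1 (leq_trans lt (ltn_ord (d k))).
    have : (c k).+1%:R <= (d k)%:R :> R by rewrite ler_nat.
    by rewrite -natr1; lra.
  have := s2 (leq_ltn_trans (leq0n _) lt).
  have : (d k).+1%:R <= (c k)%:R :> R by rewrite ler_nat.
  by rewrite -natr1; lra.
(* For [q > M + 1] not every number in range has an expansion, but then [max_val < 1] and both
   conditions hold for every sequence. *)
have [qM|qM] := leP q M.+1%:R; last first.
  have A1 : max_val < 1.
    by rewrite ltr_pdivrMr ?subr_gt0// mul1r ltrBrDr natr1.
  by have /andP[h0 h1] := seq_val_bounds (seq_shift n.+1 c); split=> _; lra.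
have /andP[h0 h1] := seq_val_bounds (seq_shift n.+1 c).
split=> cn; rewrite ltNge; apply/negP => hv.
  have [|e eE] := @exists_expansion (seq_val (seq_shift n.+1 c) - 1) qM.
    by apply/andP; split; lra.
  have lt : ((c n).+1 < M.+1)%N by rewrite ltnS.
  have E : Ordinal lt = c n.
    by apply: (univoque_seq_digit (e := e) uc); rewrite eE /= -natr1; lra.
  by move/(congr1 val)/esym/n_Sn : E.
have [|e eE] := @exists_expansion (seq_val (seq_shift n.+1 c) + 1) qM.
  by apply/andP; split; lra.
have lt : ((c n).-1 < M.+1)%N by rewrite (leq_ltn_trans (leq_pred _)).
have /(congr1 val) /= : Ordinal lt = c n.
  apply: (univoque_seq_digit (e := e) uc); rewrite eE /=.
  have : ((c n).-1.+1)%:R = (c n)%:R :> R by rewrite prednK.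
  by rewrite -natr1; lra.
by move: cn; case: (nat_of_ord (c n)) => //= m _ /n_Sn.
Qed.

Lemma univoque_seq_shift n c : univoque_seq M q c -> univoque_seq M q (seq_shift n c).
Proof.
move=> /univoque_seqP h; apply/univoque_seqP => m.
by rewrite shiftD addnS; exact: h.
Qed.

Lemma univoqueE : univoque M q = seq_val @` univoque_seq M q.
Proof.
apply/seteqP; split=> [x ux|_ [c [x ux cx] <-]].
  by have [c [cx _]] := ux; exists c; [exists x|apply/is_expansionE].
by move/is_expansionE : cx => ->.
Qed.

Lemma univoque_seq_neq0 : univoque_seq M q !=set0.
Proof.
exists (fun=> ord0); apply/univoque_seqP => n.
have -> : seq_val (seq_shift n.+1 (fun=> ord0)) = 0.
  apply/is_expansionE; rewrite /is_expansion [X in X @ _](_ : _ = cst 0).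
    exact: cvg_cst.
  by apply/funext => m; rewrite /series /= big1 // => i _; rewrite mul0r.
by split=> //= _; exact: ltr01.
Qed.

(** Tail values depend continuously on the digits by [agree_dist], and strict bounds become
    non-strict in the limit. *)
Lemma closure_admissible c : seq_closure (univoque_seq M q) c -> admissible c.
Proof.
move=> clc n.
have app (e : R) : 0 < e -> exists2 d, strict_admissible d &
    c n = d n /\ `|seq_val (seq_shift n.+1 c) - seq_val (seq_shift n.+1 d)| < e.
  move=> e0; have [m me] := exists_expVn_lt max_val e0.
  have [d /univoque_seqP ud cd] := clc (n.+1 + m)%N; exists d => //; split.
    by apply: cd; rewrite addSn ltnS leq_addr.
  apply: le_lt_trans me; apply: agree_dist => i im.
  by apply: cd; rewrite ltn_add2l.
split=> cn; apply/ler_addgt0Pl => e /app[d /(_ n)[d1 d2] [cd]];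
    rewrite ltr_norml => /andP[h1 h2].
  by move: d1; rewrite -cd => /(_ cn); lra.
by move: d2; rewrite -cd => /(_ cn); lra.
Qed.

(** At the first difference [k], with [c k < d k], the gap scaled by [q ^+ k.+1] is at least 1 plus
    the difference of the tail values. The admissibility bounds make this at least [max_val - 1],
    the range [[0, max_val]] of the tails at least [1 - max_val]. *)
Lemma admissible_separation n c d : admissible c -> admissible d ->
  ~ agree n c d -> `|max_val - 1| / q ^+ n <= `|seq_val c - seq_val d|.
Proof.
move=> ac ad /first_difference[k [kn cdk]].
wlog lt : c d ac ad cdk / (c k < d k)%N.
  move=> H ne; have := ne; rewrite -val_eqE /= neq_ltn => /orP[lt|lt].
    exact: (H c d ac ad cdk lt ne).
  rewrite [leRHS]distrC; apply: (H d c ad ac _ lt); last by rewrite eq_sym.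
  by move=> i /cdk ->.
move=> _.
have E : seq_val d - seq_val c = ((d k)%:R - (c k)%:R +
    (seq_val (seq_shift k.+1 d) - seq_val (seq_shift k.+1 c))) / q ^+ k.+1.
  rewrite (seq_val_splitS k c) (seq_val_splitS k d) (agree_prefix cdk).
  by ring.
rewrite [leRHS]distrC (le_trans _ (ler_norm _)) // E.
apply: ler_pM => //; last first.
- by rewrite lef_pV2 ?posrE // ler_eXn2l.
- have [_ /(_ (leq_ltn_trans (leq0n _) lt)) hd] := ad k.
  have [/(_ (leq_trans lt (ltn_ord (d k)))) hc _] := ac k.
  have /andP[d0 dA] := seq_val_bounds (seq_shift k.+1 d).
  have /andP[c0 cA] := seq_val_bounds (seq_shift k.+1 c).
  have : (c k).+1%:R <= (d k)%:R :> R by rewrite ler_nat.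
  rewrite -natr1 ler_norml; lra.
- by rewrite invr_ge0 ltW.
Qed.

(* Values of the admissible sequences that are not strictly admissible: after
   some prefix, the tail value is one of the two excluded bounds. *)
Definition exceptional_point (wb : seq 'I_M.+1 * bool) : R :=
  \sum_(i < size wb.1) (nth ord0 wb.1 i)%:R / q ^+ i.+1 +
  (if wb.2 then 1 else max_val - 1) / q ^+ size wb.1.

Lemma admissible_dichotomy c : admissible c ->
  univoque M q (seq_val c) \/ exists wb, seq_val c = exceptional_point wb.
Proof.
move=> ac; have [sc|] := pselect (strict_admissible c).
  by left; rewrite univoqueE; exists c => //; apply/univoque_seqP.
move=> /existsNP[n nsc]; right.
have [b bE] : exists b : bool,
    seq_val (seq_shift n.+1 c) = if b then 1 else max_val - 1.
  have [a1 a2] := ac n; apply: contrapT => nb; apply: nsc; split=> cn.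
    rewrite lt_neqAle (a1 cn) andbT; apply/eqP => E; apply: nb.
    by exists true.
  rewrite lt_neqAle (a2 cn) andbT; apply/eqP => E; apply: nb.
  by exists false.
have [w sw wE] : exists2 w : seq 'I_M.+1, size w = n.+1 &
    forall i, (i < n.+1)%N -> nth ord0 w i = c i.
  by exists (mkseq c n.+1); [exact: size_mkseq|exact: nth_mkseq].
exists (w, b); rewrite /exceptional_point /= sw -bE.
rewrite (seq_val_split n.+1); congr (_ + _).
by apply: eq_bigr => i _; rewrite wE.
Qed.

End Expansions.

(** * Counting initial words, and compactness of the sequence space *)

Section Words.
Context {M : nat}.
Implicit Types (X : set (digit_seq M)) (c d : digit_seq M) (m n k : nat).

Definition shift_stable X := forall n c, X c -> X (seq_shift n c).

Lemma initial_wordsP n X (w : n.-tuple 'I_M.+1) :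
  w \in initial_words n X <->
  exists2 c, X c & w = mktuple (fun i : 'I_n => c i).
Proof.
rewrite inE; split=> [/asboolP[c Xc wc]|[c Xc ->]].
  by exists c => //; apply: eq_from_tnth => i; rewrite tnth_mktuple.
by apply/asboolP; exists c => // i; rewrite tnth_mktuple.
Qed.

Lemma card_initial_words_gt0 n X : X !=set0 -> (0 < #|initial_words n X|)%N.
Proof.
move=> [c Xc]; apply/card_gt0P; exists (mktuple (fun i : 'I_n => c i)).
by apply/initial_wordsP; exists c.
Qed.

Lemma card_initial_words_le n X : (#|initial_words n X| <= M.+1 ^ n)%N.
Proof. by rewrite (leq_trans (max_card _)) // card_tuple card_ord. Qed.

(** A word is recovered from the index [i] of a cylinder containing it and from its part after the
    first [m i] digits, which is again an initial word by shift stability. *)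
Lemma card_initial_words_cover (I : finType) (a : I -> digit_seq M)
    (m : I -> nat) X : shift_stable X ->
    (forall c, X c -> exists i, agree (m i) c (a i)) ->
  forall k, (#|initial_words k X| <= \sum_i #|initial_words (k - m i) X|)%N.
Proof.
move=> stX cov k.
(* If [k <= m i], truncated subtraction makes [v] the empty word, and only the prefix of [a i] is
   used. *)
pose f i (v : (k - m i).-tuple 'I_M.+1) : k.-tuple 'I_M.+1 :=
  mktuple (fun j : 'I_k => if (j < m i)%N then a i j
                           else nth ord0 v (j - m i)).
have sub : initial_words k X \subset
    (\bigcup_i [set f i v | v in initial_words (k - m i) X])%SET.
  apply/fintype.subsetP => _ /initial_wordsP[c Xc ->].
  have [i ci] := cov c Xc; apply/bigcupP; exists i => //.
  apply/imsetP; exists (mktuple (fun j : 'I_(k - m i) => seq_shift (m i) c j)).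
    by apply/initial_wordsP; exists (seq_shift (m i) c) => //; exact: stX.
  apply: eq_from_tnth => j; rewrite !tnth_mktuple.
  have [ji|ji] := ltnP j (m i); first exact: ci.
  have jk : (j - m i < k - m i)%N by rewrite ltn_sub2r // (leq_ltn_trans ji).
  by rewrite -[RHS](tnth_nth _ _ (Ordinal jk)) tnth_mktuple /seq_shift /= subnKC.
apply: leq_trans (subset_leq_card sub) _.
elim/big_ind2 : _ => [|A x B y Ax By|i _]; first by rewrite cards0.
  by rewrite (leq_trans (leq_card_setU _ _)) // leq_add.
exact: leq_imset_card.
Qed.

Lemma card_initial_wordsD m n X : shift_stable X ->
  (#|initial_words (m + n) X| <= #|initial_words m X| * #|initial_words n X|)%N.
Proof.
move=> stX.
pose f (uv : m.-tuple 'I_M.+1 * n.-tuple 'I_M.+1) : (m + n).-tuple 'I_M.+1 :=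
  mktuple (fun j : 'I_(m + n) => if (j < m)%N then nth ord0 uv.1 j
                                 else nth ord0 uv.2 (j - m)).
rewrite -cardsX; apply: leq_trans (leq_imset_card f _).
apply/subset_leq_card/fintype.subsetP => _ /initial_wordsP[c Xc ->].
apply/imsetP; exists (mktuple (fun i : 'I_m => c i),
                      mktuple (fun i : 'I_n => seq_shift m c i)).
  rewrite inE /=; apply/andP; split; apply/initial_wordsP; first by exists c.
  by exists (seq_shift m c) => //; exact: stX.
apply: eq_from_tnth => j; rewrite !tnth_mktuple.
have [jm|jm] := ltnP j m.
  by rewrite -[RHS](tnth_nth _ _ (Ordinal jm)) tnth_mktuple.
have jk : (j - m < n)%N by rewrite ltn_subLR.
by rewrite -[RHS](tnth_nth _ _ (Ordinal jk)) tnth_mktuple /seq_shift /= subnKC.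
Qed.

(* Strong induction on k, cutting off the first block of a word. *)
Lemma card_initial_words_growth (R : realType) (I : finType)
    (a : I -> digit_seq M) (m : I -> nat) X (t : R) : shift_stable X ->
    (forall c, X c -> exists i, agree (m i) c (a i)) ->
    (forall i, (0 < m i)%N) -> 0 < t <= 1 -> \sum_i t ^+ m i <= 1 ->
  exists2 C : R, 0 < C & forall k, #|initial_words k X|%:R <= C / t ^+ k.
Proof.
move=> stX cov m0 /andP[t0 t1] sum1.
have tn0 n : 0 < t ^+ n by rewrite exprn_gt0.
(* Below [L] the trivial bound [M.+1 ^ L] suffices, as [t <= 1]; from [L] on no difference [k - m i]
   is truncated. *)
pose L := (\max_i m i)%N; pose C : R := (M.+1 ^ L)%:R.
have C0 : 0 < C by rewrite ltr0n expn_gt0.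
exists C => // k; elim/ltn_ind: k => k IH.
have [kL|Lk] := ltnP k L.
  rewrite ler_pdivlMr // (@le_trans _ _ #|initial_words k X|%:R) //.
    by rewrite ler_piMr // exprn_ile1 // ltW.
  rewrite ler_nat (leq_trans (card_initial_words_le _ _)) //.
  by rewrite leq_pexp2l // ltnW.
apply: (@le_trans _ _ (\sum_i #|initial_words (k - m i) X|%:R)).
  by rewrite -natr_sum ler_nat; exact: (card_initial_words_cover stX cov).
apply: (@le_trans _ _ (\sum_i C / t ^+ k * t ^+ m i)).
  apply: ler_sum => i _.
  have mk : (m i <= k)%N by apply: leq_trans Lk; exact: leq_bigmax.
  have /IH/le_trans : (k - m i < k)%N by rewrite ltn_subrL m0 (leq_trans (m0 i)).
  apply; rewrite -[in leRHS](subnK mk) exprD invfM -!mulrA mulVf ?gt_eqF//.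
  by rewrite mulr1.
by rewrite -mulr_sumr ler_piMr // divr_ge0 // ltW.
Qed.

(** The digits of the cluster point are chosen one by one so that each prefix is shared by [d N] for
    arbitrarily large [N]. *)
Lemma cluster_seq (d : nat -> digit_seq M) :
  exists c, forall n m, exists2 N, (m <= N)%N & agree n c (d N).
Proof.
pose P n c := forall m, exists2 N, (m <= N)%N & agree n c (d N).
pose upd n c (x : 'I_M.+1) : digit_seq M := fun i => if i == n then x else c i.
have step n c : exists x, P n c -> P n.+1 (upd n c x).
  have [Pc|nP] := pselect (P n c); last by exists ord0.
  apply: contrapT => nx.
  (* Pigeonhole: if no digit [x] continued the prefix infinitely often, each would have a bound
     [B x], and some [d N] with the prefix and [N] beyond all bounds contradicts the one for
     [x = d N n]. *)
  have /choice[B hB] (x : 'I_M.+1) : exists m, forall N, (m <= N)%N ->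
      ~ agree n.+1 (upd n c x) (d N).
    apply: contrapT => nm; apply: nx; exists x => _ m; apply: contrapT => nN.
    by apply: nm; exists m => N mN ag; apply: nN; exists N.
  have [N BN cN] := Pc (\max_x B x)%N.
  apply: (hB (d N n) N (leq_trans (leq_bigmax _) BN)) => i.
  rewrite ltnS leq_eqVlt /upd => /orP[/eqP ->|i_n]; first by rewrite eqxx.
  by rewrite ltn_eqF // cN.
have [g gP] := choice (fun nc : nat * digit_seq M => step nc.1 nc.2).
pose s := fix s n : digit_seq M :=
  if n is n'.+1 then upd n' (s n') (g (n', s n')) else fun=> ord0.
have sP n : P n (s n).
  elim: n => [|n IH]; first by move=> m; exists m.
  exact: (gP (n, s n)).
have s_stable i n : (i < n)%N -> s n i = s i.+1 i.
  elim: n => // n IH; rewrite ltnS leq_eqVlt => /orP[/eqP ->//|i_n].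
  by rewrite [LHS]/= /upd ltn_eqF // IH.
exists (fun i => s i.+1 i) => n m; have [N mN ag] := sP n m; exists N => // i i_n.
by rewrite -ag // s_stable.
Qed.

(** Each [O i] is open, being determined by [l i] digits. If for every [N] some [d N] in [X] escaped
    the first [N] sets, a cluster point of [d] would lie in the closure, hence in some [O i], and so
    would some [d N] with [N > i]. *)
Lemma finite_subcover X (O : nat -> set (digit_seq M)) (l : nat -> nat) :
    (forall i c d, agree (l i) c d -> O i c -> O i d) ->
    (forall c, seq_closure X c -> exists i, O i c) ->
  exists N, forall c, X c -> exists2 i, (i < N)%N & O i c.
Proof.
move=> locO cov; apply: contrapT => nN.
have /choice[d dP] N : exists c, X c /\ forall i, (i < N)%N -> ~ O i c.
  apply: contrapT => nc; apply: nN; exists N => c Xc.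
  apply: contrapT => ni; apply: nc; exists c; split=> // i iN Oi.
  by apply: ni; exists i.
have [c cP] := cluster_seq d.
have [n|i Oi] := cov c.
  by have [N _ ag] := cP n 0%N; exists (d N) => //; case: (dP N).
have [N iN ag] := cP (l i) i.+1.
by case: (dP N) => _ /(_ i iN); apply; exact: locO ag Oi.
Qed.

End Words.

(** * Fekete's lemma for nonnegative subadditive sequences *)

Section Fekete.
Context {R : realType} (u : nat -> R).
Hypothesis u_ge0 : forall n, 0 <= u n.
Hypothesis uD : forall m n, u (m + n)%N <= u m + u n.

Lemma subadditive_mul m n k : u (k * m + n)%N <= k%:R * u m + u n.
Proof.
elim: k => [|k IH]; first by rewrite mul0n add0n mul0r add0r.
by rewrite mulSn -addnA (le_trans (uD _ _)) // -natr1 mulrDl mul1r; lra.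
Qed.

Lemma subadditive_cvg :
  (fun n => u n / n%:R) @ \oo -->
  inf [set u n / n%:R | n in [set n | (1 <= n)%N]].
Proof.
set E := [set _ | _ in _]; set l := inf E.
have E0 : E !=set0 by exists (u 1%N / 1); exists 1%N.
have lbE : has_lbound E.
  by exists 0 => _ [n _ <-]; rewrite divr_ge0.
apply/cvgrPdist_lt => e e0.
have e20 : 0 < e / 2 by rewrite divr_gt0.
have [_ [m /= m1 <-] um] := inf_adherent e20 (conj E0 lbE).
(* [C] bounds [u] at every remainder modulo [m], so division of [n] by [m] gives
   [u n / n <= u m / m + C / n]. *)
pose C := m%:R * u 1%N + u 0%N.
have C0 : 0 <= C by rewrite addr_ge0 // mulr_ge0.
near=> n.
have n1 : (1 <= n)%N by near: n; exact: nbhs_infty_ge.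
have n0 : 0 < n%:R :> R by rewrite ltr0n.
have m0 : 0 < m%:R :> R by rewrite ltr0n.
have Cn : C / n%:R < e / 2.
  rewrite ltr_pdivrMr // mulrC -ltr_pdivrMr //.
  by near: n; exact: nbhs_infty_gtr.
have ln : l <= u n / n%:R by apply: ge_inf => //; exists n.
rewrite distrC ger0_norm ?subr_ge0// ltrBlDl.
have ur : u (n %% m)%N <= C.
  have := subadditive_mul 1 0 (n %% m)%N; rewrite muln1 addn0 => /le_trans.
  by apply; rewrite lerD2r ler_wpM2r // ler_nat ltnW // ltn_mod.
have un : u n <= (n %/ m)%:R * u m + C.
  by rewrite {1}(divn_eq n m) (le_trans (subadditive_mul _ _ _)) // lerD2l.
have kn : (n %/ m)%:R * u m <= n%:R * (u m / m%:R).
  by rewrite mulrA ler_pdivlMr // mulrAC ler_wpM2r // -natrM ler_nat leq_trunc_div.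
have : u n / n%:R <= u m / m%:R + C / n%:R.
  by rewrite ler_pdivrMr // mulrDl divfK ?gt_eqF// (mulrC (u m / _)); lra.
by lra.
Unshelve. all: by end_near. Qed.
End Fekete.

(** * Entropy of shift-stable sets *)

Section Entropy.
Context {R : realType} {M : nat} (X : set (digit_seq M)).
Hypotheses (stX : shift_stable X) (X0 : X !=set0).

Let B n : R := #|initial_words n X|%:R.

Let B_ge1 n : 1 <= B n.
Proof. by rewrite ler1n card_initial_words_gt0. Qed.

Let B_gt0 n : 0 < B n. Proof. exact: lt_le_trans (B_ge1 n). Qed.

Lemma ln2_gt0 : 0 < ln (2 : R).
Proof. by rewrite ln_gt0 // ltr1n. Qed.

Lemma word_growth_cvg : word_growth R X @ \oo -->
  inf [set word_growth R X n | n in [set n | (1 <= n)%N]].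
Proof.
apply: (@subadditive_cvg _ (fun n => log2 (B n))) => [n|m n].
  by rewrite divr_ge0 ?ln_ge0 ?B_ge1 ?ler1n.
rewrite /log2 -mulrDl ler_pM2r ?invr_gt0 ?ln2_gt0// -lnM ?posrE//.
by rewrite ler_ln ?posrE ?mulr_gt0// -natrM ler_nat card_initial_wordsD.
Qed.

Lemma entropyE :
  entropy R X = inf [set word_growth R X n | n in [set n | (1 <= n)%N]].
Proof. exact: cvg_lim word_growth_cvg. Qed.

Lemma word_growth_ge0 n : 0 <= word_growth R X n.
Proof. by rewrite !divr_ge0 ?ln_ge0 ?B_ge1 ?ler1n. Qed.

Lemma entropy_ge0 : 0 <= entropy R X.
Proof.
rewrite entropyE; apply: lb_le_inf => [|_ [n _ <-]]; last exact: word_growth_ge0.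
by exists (word_growth R X 1), 1%N.
Qed.

Lemma entropy_le_word_growth n : (1 <= n)%N -> entropy R X <= word_growth R X n.
Proof.
move=> n1; rewrite entropyE; apply: ge_inf; last by exists n.
by exists 0 => _ [m _ <-]; exact: word_growth_ge0.
Qed.

Lemma entropy_le_growth_rate (C t : R) : 0 < C -> 0 < t ->
  (forall k, B k <= C / t ^+ k) -> entropy R X <= - log2 t.
Proof.
move=> C0 t0 BC; apply/ler_addgt0Pl => e e0.
(* The entropy is an infimum, so a single length suffices; at length [k.+1] the constant [C]
   contributes less than [e]. *)
have [k kC] : exists k, log2 C / e < k%:R.
  by exists (Num.truncn (log2 C / e)).+1; exact: truncnS_gt.
have k0 : 0 < k.+1%:R :> R by rewrite ltr0n.
apply: le_trans (entropy_le_word_growth (ltn0Sn k)) _.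
rewrite ler_pdivrMr // /log2 ler_pdivrMr ?ln2_gt0//.
have tk0 : 0 < t ^+ k.+1 by rewrite exprn_gt0.
have := BC k.+1; rewrite -ler_ln ?posrE ?divr_gt0// => /le_trans; apply.
rewrite lnM ?posrE ?invr_gt0// lnV ?posrE// lnXn // -[ln t *+ _]mulr_natr.
have : ln C < e * ln 2 * k.+1%:R.
  rewrite ltr_pdivrMr // ltr_pdivrMr ?ln2_gt0// in kC.
  apply: (lt_le_trans kC); rewrite -natr1.
  rewrite -mulrA mulrC ler_pM2l ?mulr_gt0 ?ln2_gt0//.
  by lra.
have : (e + - (ln t / ln 2)) * k.+1%:R * ln 2
       = e * ln 2 * k.+1%:R - ln t * k.+1%:R.
  by field; rewrite gt_eqF ?ln2_gt0.
by move=> ->; lra.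
Qed.

End Entropy.

(** * Hausdorff measure and covers by sets of real diameter *)

Section Hausdorff.
Context {R : realType}.
Implicit Types (A F : set R) (s d : R).
Local Open Scope ereal_scope.

Lemma diam_le A d :
  (forall x y, A x -> A y -> `|x - y| <= d)%R -> diam A <= d%:E.
Proof. by move=> h; apply: ge_ereal_sup => _ [x Ax [y Ay <-]]; rewrite lee_fin h. Qed.

Lemma le_diam A x y : A x -> A y -> (`|x - y|%R)%:E <= diam A.
Proof. by move=> Ax Ay; apply: ereal_sup_ubound; exists x => //; exists y. Qed.

Lemma diam_pow_ge0 s A : 0 <= diam_pow s A.
Proof. by rewrite /diam_pow; case: ifP => // _; exact: poweR_ge0. Qed.

Lemma diam_pow0 s : diam_pow s (set0 : set R) = 0.
Proof. by rewrite /diam_pow asboolT. Qed.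

Lemma diam_ge0 A : A !=set0 -> 0 <= diam A.
Proof. by move=> [x Ax]; have := le_diam Ax Ax; rewrite subrr normr0. Qed.

Lemma diam_pow_le s A d : (0 <= s)%R -> (0 <= d)%R -> diam A <= d%:E ->
  diam_pow s A <= (d `^ s)%:E.
Proof.
move=> s0 d0 Ad; rewrite /diam_pow; case: asboolP => [_|/eqP/set0P A0].
  by rewrite lee_fin powR_ge0.
rewrite -poweR_EFin; apply: gt0_ler_poweR => //.
  by rewrite in_itv /= leey andbT; exact: diam_ge0.
by rewrite in_itv /= leey andbT lee_fin.
Qed.

Lemma hausdorff_measure_ge0 s A : 0 <= hausdorff_measure s A.
Proof.
apply: (@le_trans _ _ (hausdorff_premeasure s 1 A)); last first.
  by apply: ereal_sup_ubound; exists 1%R; [exact: ltr01|].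
apply: le_ereal_inf_tmp => _ [F _ <-].
by apply: nneseries_ge0 => i _ _; exact: diam_pow_ge0.
Qed.

Lemma diam_pow_radius s s' d0 F : (0 <= s < s')%R -> (0 <= d0 <= 1)%R ->
    diam F <= d0%:E ->
  exists d, [/\ (0 <= d <= d0)%R,
    (forall x y, F x -> F y -> `|x - y| <= d)%R &
    (d `^ s')%:E <= diam_pow s F].
Proof.
move=> /andP[s0 ss'] /andP[d00 d01] Fd.
have s'0 : (0 < s')%R by exact: le_lt_trans ss'.
have [->|/set0P F0] := eqVneq F set0.
  exists 0%R; split=> //; first by rewrite lexx.
  by rewrite diam_pow0 powR0 // gt_eqF.
have diam0 := diam_ge0 F0.
have dE : diam F = (fine (diam F))%:E.
  by rewrite fineK // ge0_fin_numE // (le_lt_trans Fd) ?ltry.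
exists (fine (diam F)); rewrite fine_ge0 //=; split.
- by rewrite -lee_fin -dE.
- by move=> x y Fx Fy; rewrite -lee_fin -dE; exact: le_diam.
rewrite /diam_pow asboolF; last by apply/eqP/set0P.
rewrite dE poweR_EFin lee_fin /=.
have [->|n0] := eqVneq (fine (diam F)) 0%R.
  by rewrite powR0 ?powR_ge0 // gt_eqF.
rewrite ger_powR ?(ltW ss')// lt_neqAle eq_sym n0 fine_ge0 //=.
by rewrite (le_trans _ d01) // -lee_fin -dE.
Qed.

Lemma hausdorff_null_cover s s' d0 (e : R) A : (0 <= s < s')%R ->
    (0 < d0 <= 1)%R -> (0 < e)%R -> hausdorff_measure s A = 0 ->
  exists (F : nat -> set R) (d : nat -> R), [/\ A `<=` \bigcup_i F i,
    (forall i, 0 <= d i <= d0)%R,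
    (forall i x y, F i x -> F i y -> `|x - y| <= d i)%R &
    \sum_(0 <= i <oo) (d i `^ s')%:E < e%:E].
Proof.
move=> ss' /andP[d00 d01] e0 A0.
have : hausdorff_premeasure s d0 A < e%:E.
  rewrite (@le_lt_trans _ _ 0) // -A0; apply: ereal_sup_ubound.
  by exists d0.
move=> /ereal_inf_lt[_ [F [AF Fd] <-] Fe].
have /choice[d dP] i := diam_pow_radius ss' (introT andP (conj (ltW d00) d01)) (Fd i).
exists F, d; split=> // [i|i|]; [by case: (dP i)..|].
apply: le_lt_trans Fe; apply: lee_nneseries => i _; last by case: (dP i).
by rewrite lee_fin powR_ge0.
Qed.

End Hausdorff.

(** * Upper and lower bounds for the dimension *)

Lemma sum_half_pow (R : realType) (N : nat) :
  \sum_(i < N) (2 ^+ i.+1)^-1 = 1 - (2 ^+ N)^-1 :> R.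
Proof.
elim: N => [|N IH]; first by rewrite big_ord0 expr0 invr1 subrr.
by rewrite big_ord_recr /= IH exprS; field; rewrite expf_neq0.
Qed.

Section Dimension.
Context {R : realType} {M : nat} (q : R).
Hypothesis q_gt1 : 1 < q.
Local Notation U := (univoque_seq M q).
Local Notation A := (@max_val R M q).

Let q_gt0 : 0 < q. Proof. exact: lt_trans q_gt1. Qed.
Let qn_gt0 n : 0 < q ^+ n. Proof. exact: exprn_gt0. Qed.

Let stU : shift_stable U.
Proof. by move=> n c; exact: univoque_seq_shift. Qed.

Let U0 : U !=set0. Proof. exact: univoque_seq_neq0. Qed.

Lemma log2_gt0 : 0 < log2 q.
Proof. by rewrite divr_gt0 ?ln_gt0 ?ltr1n. Qed.

Lemma powR_gt1 (s : R) : 0 < s -> 1 < q `^ s.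
Proof.
move=> s0; have -> : 1 = 1 `^ s :> R by rewrite powR1.
by apply: gt0_ltr_powR => //; rewrite nnegrE ltW.
Qed.

Lemma powR_expVn (s : R) n : (q ^+ n)^-1 `^ s = (q `^ s ^+ n)^-1.
Proof.
rewrite -(powR_mulrn n (ltW q_gt0)) -powRN -powRrM mulNr powRN mulrC powRrM.
by rewrite powR_mulrn ?powR_ge0.
Qed.

Lemma hausdorff_null_above (s : R) : entropy R U / log2 q < s ->
  hausdorff_measure s (univoque M q) = 0%E.
Proof.
move=> hs.
have s0 : 0 < s.
  by apply: le_lt_trans hs; rewrite divr_ge0 ?entropy_ge0 // ltW // log2_gt0.
apply/eqP; rewrite eq_le hausdorff_measure_ge0 andbT.
apply: ge_ereal_sup => _ [delta /= delta0 <-].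
apply/lee_addgt0Pr => e e0; rewrite add0e.
pose s1 := (entropy R U / log2 q + s) / 2.
have s1s : s1 < s by rewrite /s1; lra.
have hs1 : entropy R U < s1 * log2 q.
  by rewrite -ltr_pdivrMr ?log2_gt0 // /s1; lra.
have [n [n0 gn small Adelta]] : exists n, [/\ (0 < n)%N,
    word_growth R U n < s1 * log2 q,
    A `^ s / (q `^ (s - s1)) ^+ n < e & A / q ^+ n < delta].
  have p1 : 1 < q `^ (s - s1) by rewrite powR_gt1 // subr_gt0.
  have /cvgrPdist_lt/(_ _ e0) c1 := expVn_cvg0 p1 (A `^ s).
  have /cvgrPdist_lt/(_ _ delta0) c2 := expVn_cvg0 q_gt1 A.
  have : \forall n \near \oo, word_growth R U n < s1 * log2 q.
    have /cvgrPdist_lt cv := word_growth_cvg (R := R) stU U0.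
    rewrite -entropyE // in cv.
    have /cv c : 0 < s1 * log2 q - entropy R U by rewrite subr_gt0.
    by apply: filterS c => n; rewrite ltr_norml => /andP[]; lra.
  move=> c3; near \oo => n; exists n; split.
  - by near: n; exact: nbhs_infty_gt.
  - by near: n.
  - apply: le_lt_trans (ler_norm _) _; rewrite -normrN -[- _]sub0r.
    by near: n.
  - apply: le_lt_trans (ler_norm _) _; rewrite -normrN -[- _]sub0r.
    by near: n.
pose W := enum (initial_words n U); pose r := A / q ^+ n.
have r0 : 0 <= r by rewrite divr_ge0 ?max_val_ge0 // ltW.
(* The cover is indexed by all naturals; beyond the last word [F i] is empty and has gauge 0. *)
pose F i : set R := [set x | (i < size W)%N /\ exists2 c, U c &
  seq_val q c = x /\ nth (mktuple (fun=> ord0)) W i = mktuple (fun j : 'I_n => c j)].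
have Fr i : (diam (F i) <= r%:E)%E.
  apply: diam_le => _ _ [_ [c _ [<- cw]]] [_ [d _ [<- dw]]].
  apply: agree_dist => // j jn.
  have := congr1 (fun w => tnth w (Ordinal jn)) (etrans (esym cw) dw).
  by rewrite !tnth_mktuple.
apply: (@le_trans _ _ (\sum_(0 <= i <oo) diam_pow s (F i))%E).
  apply: ereal_inf_lbound; exists F => //; split=> [x|i].
    rewrite univoqueE // => -[c Uc <-].
    pose w := mktuple (fun j : 'I_n => c j).
    have wW : w \in W by rewrite mem_enum; apply/initial_wordsP; exists c.
    exists (index w W) => //; split; first by rewrite index_mem.
    by exists c => //; split=> //; rewrite nth_index.
  by apply: le_trans (Fr i) _; rewrite lee_fin ltW.
rewrite (nneseries_split 0 (size W)); last by move=> k _; exact: diam_pow_ge0.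
rewrite eseries0 ?adde0 => [|i Wi _]; last first.
  rewrite (_ : F i = set0) ?diam_pow0 // -subset0 => x [].
  by rewrite ltnNge -[size W]add0n Wi.
apply: (@le_trans _ _ (\sum_(0 <= k < 0 + size W) (r `^ s)%:E)%E).
  by apply: lee_sum => i _; apply: diam_pow_le; rewrite // ltW.
rewrite sumEFin lee_fin add0n big_const_nat subn0 iter_addr addr0 -cardE.
apply: le_trans (ltW small).
rewrite -mulr_natl powRM ?max_val_ge0 ?invr_ge0 ?(ltW (qn_gt0 n))// powR_expVn.
rewrite mulrCA ler_wpM2l ?powR_ge0//.
have qs0 x : 0 < q `^ x by exact: powR_gt0.
have qsn0 x : 0 < q `^ x ^+ n by rewrite exprn_gt0.
have -> : q `^ s = q `^ (s - s1) * q `^ s1.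
  by rewrite -powRD ?subrK // (gt_eqF q_gt0) implybT.
rewrite ler_pdivrMr ?exprn_gt0 ?mulr_gt0// ler_pdivlMl //.
rewrite exprMn ler_pM2l // -ler_ln ?posrE// ?ltr0n ?card_initial_words_gt0//.
rewrite lnXn // ln_powR -[leRHS]mulr_natr ltW //.
move: gn; rewrite /word_growth /log2 ltr_pdivrMr ?ltr0n// ltr_pdivrMr ?ln2_gt0//.
rewrite (_ : s1 * (ln q / ln 2) * n%:R * ln 2 = s1 * ln q * n%:R) //.
by field; rewrite gt_eqF ?ln2_gt0.
Unshelve. all: by end_near. Qed.

(** For [d > 0] the largest [n] with [d < delta / q ^+ n] works, since [delta / q ^+ n.+1 <= d]. For
    [d = 0] there is no largest [n], and the slack [e] takes over. *)
Lemma scale_choice (delta s d e : R) : 0 < delta -> 0 < s -> 0 <= d < delta ->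
    0 < e ->
  exists n, d < delta / q ^+ n /\
    ((q `^ s)^-1) ^+ n <= (q / delta) `^ s * d `^ s + e.
Proof.
move=> delta0 s0 /andP[d0 dd] e0.
have [->|dn0] := eqVneq d 0.
  have [n ne] := exists_expVn_lt (powR_gt1 s0) 1 e0; exists n.
  rewrite divr_gt0 //; split=> //; rewrite powR0 ?gt_eqF// mulr0 add0r exprVn.
  by rewrite -div1r ltW.
have {d0 dn0} d0 : 0 < d by rewrite lt_neqAle eq_sym dn0.
have ex : exists n, delta / q ^+ n <= d.
  by have [n] := exists_expVn_lt q_gt1 delta d0; exists n; exact: ltW.
case: (ex_minnP ex) => -[|n]; first by rewrite expr0 divr1 leNgt dd.
move=> nd nmin; exists n; split.
  by rewrite ltNge; apply/negP => /nmin; rewrite ltnn.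
apply: (@le_trans _ _ ((q / delta) `^ s * d `^ s)); last by rewrite lerDl ltW.
have qd0 : 0 < q / delta by rewrite divr_gt0.
rewrite -powRM ?(ltW d0) ?(ltW qd0)// exprVn -powR_expVn.
apply: (ge0_ler_powR (ltW s0)); rewrite ?nnegrE.
- by rewrite invr_ge0 ltW.
- by rewrite mulr_ge0 // ltW.
move: nd; rewrite exprS ler_pdivrMr ?mulr_gt0// => nd.
have -> : q / delta * d = d * (q * q ^+ n) / delta / q ^+ n.
  by field; rewrite !gt_eqF.
by rewrite -[leLHS]mul1r ler_wpM2r ?invr_ge0 ?(ltW (qn_gt0 n))// ler_pdivlMr ?mul1r.
Qed.

Lemma cylinder_capture (F : set R) n :
    (forall x y, F x -> F y -> `|x - y| < `|A - 1| / q ^+ n) ->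
  exists a : digit_seq M, forall c, admissible q c -> F (seq_val q c) ->
    agree n c a.
Proof.
move=> Fn.
have [[a aa Fa]|h] := pselect (exists2 a : digit_seq M, admissible q a &
    F (seq_val q a)); last first.
  by exists (fun=> ord0) => c ac Fc; exfalso; apply: h; exists c.
exists a => c ac Fc; apply: contrapT => /(admissible_separation q_gt1 ac aa).
by rewrite leNgt Fn.
Qed.

Lemma cylinder_choice (F : set R) (s d e : R) : A != 1 -> 0 < s ->
    0 <= d < `|A - 1| -> 0 < e ->
    (forall x y, F x -> F y -> `|x - y| <= d) ->
  exists an : digit_seq M * nat,
    (forall c, admissible q c -> F (seq_val q c) -> agree an.2 c an.1) /\
    ((q `^ s)^-1) ^+ an.2 <= (q / `|A - 1|) `^ s * d `^ s + e.
Proof.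
move=> A1 s0 dd e0 Fd.
have delta0 : 0 < `|A - 1| by rewrite normr_gt0 subr_eq0.
have [n [dn tn]] := scale_choice delta0 s0 dd e0.
have [x y Fx Fy|a aP] := @cylinder_capture F n.
  exact: le_lt_trans (Fd _ _ Fx Fy) dn.
by exists (a, n).
Qed.

(** Enumerates the countably many exceptional points; the padding value 0 only adds a point to be
    covered. *)
Definition exceptional_seq (i : nat) : R :=
  if unpickle i is Some wb then @exceptional_point R M q wb else 0.

Lemma admissible_dichotomy_seq (c : digit_seq M) : admissible q c ->
  univoque M q (seq_val q c) \/ exists i, seq_val q c = exceptional_seq i.
Proof.
move=> /(admissible_dichotomy q_gt1)[|[wb ->]]; [by left|right].
by exists (pickle wb); rewrite /exceptional_seq pickleK.
Qed.

Lemma entropy_le_of_hausdorff_null (s s' : R) : A != 1 -> 0 <= s < s' ->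
  hausdorff_measure s (univoque M q) = 0%E -> entropy R U <= s' * log2 q.
Proof.
move=> A1 ss' H0.
have s'0 : 0 < s' by case/andP: ss' => /le_lt_trans; exact.
have delta0 : 0 < `|A - 1| by rewrite normr_gt0 subr_eq0.
set t := (q `^ s')^-1; set K := (q / `|A - 1|) `^ s'.
have t0 : 0 < t by rewrite invr_gt0 powR_gt0.
have t1 : t < 1 by rewrite invf_lt1 ?powR_gt0 ?powR_gt1.
have K0 : 0 <= K by exact: powR_ge0.
(* The bound 1 is needed for raising the exponent to [s'], the bound below [|A - 1|] for choosing a
   scale. *)
pose d0 := Num.min 1 (`|A - 1| / 2).
have d0b : 0 < d0 <= 1 by rewrite lt_min ltr01 divr_gt0 //= ge_min lexx.
have d0A : d0 < `|A - 1|.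
  by rewrite gt_min; apply/orP; right; lra.
have e0 : 0 < (4 * (K + 1))^-1 by rewrite invr_gt0; lra.
have [F [d [UF db Fd sumd]]] := hausdorff_null_cover ss' d0b e0 H0.
have h0 i : 0 < 4^-1 / 2 ^+ i.+1 :> R by rewrite divr_gt0 // exprn_gt0.
have /choice[an anP] i := cylinder_choice (d := d i) A1 s'0
  (introT andP (conj (andP (db i)).1 (le_lt_trans (andP (db i)).2 d0A)))
  (h0 i) (Fd i).
(* A single point has diameter 0, so its cylinder can be taken as long as desired. *)
have /choice[bm bmP] i : exists bm : digit_seq M * nat,
    (forall c, admissible q c -> seq_val q c = exceptional_seq i ->
      agree bm.2 c bm.1) /\ t ^+ bm.2 <= 4^-1 / 2 ^+ i.+1.
  have [||bm [h1 h2]] := @cylinder_choice [set exceptional_seq i] s' 0 _ A1 s'0 _ (h0 i).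
  - by rewrite lexx.
  - by move=> _ _ -> ->; rewrite subrr normr0.
  exists bm; split=> //; apply: le_trans h2 _.
  by rewrite powR0 ?gt_eqF// mulr0 add0r.
have [|c /closure_admissible-/(_ q_gt1) ac|N NP] := @finite_subcover M U
    (fun i => [set c | agree (an i).2 c (an i).1 \/ agree (bm i).2 c (bm i).1])
    (fun i => maxn (an i).2 (bm i).2).
- move=> i c c' cc' [] h; [left|right] => j jn; rewrite -cc' ?h //.
    by rewrite leq_max jn.
  by rewrite leq_max jn orbT.
- have [/UF[i _ Fi]|[i ei]] := admissible_dichotomy_seq ac.
    by exists i; left; apply: (anP i).1.
  by exists i; right; apply: (bmP i).1.
pose f (i : 'I_N + 'I_N) := match i with inl i => an i | inr i => bm i end.
have sumd' : \sum_(i < N) d i `^ s' <= (4 * (K + 1))^-1.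
  rewrite -lee_fin -sumEFin; apply: le_trans (ltW sumd).
  rewrite -(big_mkord xpredT (fun i => (d i `^ s')%:E)).
  by apply: nneseries_lim_ge => i _ _; rewrite lee_fin powR_ge0.
have sum1 : \sum_i t ^+ (f i).2 < 1.
  rewrite big_sumType /=.
  have S1 : \sum_(i < N) t ^+ (an i).2 <=
      K * \sum_(i < N) d i `^ s' + 4^-1 * \sum_(i < N) (2 ^+ i.+1)^-1.
    rewrite !mulr_sumr -big_split /=; apply: ler_sum => i _.
    exact: (anP i).2.
  have S2 : \sum_(i < N) t ^+ (bm i).2 <= 4^-1 * \sum_(i < N) (2 ^+ i.+1)^-1.
    by rewrite mulr_sumr; apply: ler_sum => i _; exact: (bmP i).2.
  have S3 : K * \sum_(i < N) d i `^ s' <= 4^-1.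
    apply: le_trans (ler_wpM2l K0 sumd') _.
    by rewrite ler_pdivrMr ?mulr_gt0 //; lra.
  have S4 : \sum_(i < N) (2 ^+ i.+1)^-1 <= 1 :> R.
    by rewrite sum_half_pow lerBlDr lerDl invr_ge0 exprn_ge0.
  by lra.
have [c Uc|i|||C C0 CP] := @card_initial_words_growth M R _
    (fun i => (f i).1) (fun i => (f i).2) U t stU.
- have [i iN [h|h]] := NP c Uc.
    by exists (inl (Ordinal iN)).
  by exists (inr (Ordinal iN)).
(* A cylinder of length 0 would alone have weight 1. *)
- rewrite lt0n; apply/eqP => fi; move: sum1.
  rewrite (bigD1 i) //= fi expr0 ltNge lerDl sumr_ge0 // => j _.
  by rewrite exprn_ge0 // ltW.
- by rewrite t0 ltW.
- exact: ltW.
have := entropy_le_growth_rate stU U0 C0 t0 CP.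
rewrite /log2 /t lnV ?posrE ?powR_gt0// ln_powR.
by rewrite mulNr opprK mulrA.
Qed.

(** Here [|A - 1| = 0] and separation is lost, but tail values lie in [[0, 1] = [A - 1, 1]], so
    every sequence is admissible and [[0, 1]] is univoque up to exceptional points. For [s < 1] the
    exponent can be raised to 1, which gives a cover of total length below 1. *)
Lemma hausdorff_null_ge1 (s : R) : A = 1 -> 0 <= s ->
  hausdorff_measure s (univoque M q) = 0%E -> 1 <= s.
Proof.
move=> A1 s0 H0; rewrite leNgt; apply/negP => s1.
have qM := max_val_eq1 q_gt1 A1.
have adm (c : digit_seq M) : admissible q c.
  move=> n; have := @seq_val_bounds R M q q_gt1 (seq_shift n.+1 c).
  by rewrite A1 subrr => /andP[].
have [|||F [d [UF db Fd sumd]]] := @hausdorff_null_cover _ s 1 1 4^-1 _ _ _ _ H0.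
- by rewrite s0.
- by rewrite ltr01 lexx.
- by rewrite invr_gt0.
(* The centre is any point of [F i], so the interval has length [2 * d i]; as the [d i] sum to less
   than 1/4, the total stays below 1/2. The exceptional points added in [G] have measure 0. *)
have /choice[x xP] i : exists x, F i `<=` `[x - d i, x + d i]%classic.
  have [->|/set0P[x Fx]] := eqVneq (F i) set0; first by exists 0.
  exists x => y Fy /=; rewrite in_itv /=.
  by have := Fd i _ _ Fx Fy; rewrite ler_norml; lra.
pose G i : set R := `[x i - d i, x i + d i]%classic `|` [set exceptional_seq i].
have cov : `[0, 1]%classic `<=` \bigcup_i G i.
  move=> y; rewrite /= in_itv /= => y01.
  have [||c cy] := @exists_expansion R M q q_gt1 y; [by rewrite qM|by rewrite A1|].
  have [] := admissible_dichotomy_seq (adm c); rewrite cy.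
    by move=> /UF[i _ /xP Fi]; exists i => //; left.
  by move=> [i ->]; exists i => //; right.
have mG i : measurable (G i) by apply: measurableU.
have Gd i : (lebesgue_measure (G i) <= 2%:E * (d i `^ 1)%:E)%E.
  have /andP[di0 _] := db i.
  apply: le_trans (measureU2 _ _ _) _ => //.
  rewrite [X in (_ + X)%E]lebesgue_measure_set1 adde0.
  rewrite [X in (X <= _)%E]lebesgue_measure_itv /= powRr1 // -EFinM; case: ifP => _; rewrite lee_fin; last by rewrite mulr_ge0.
  by lra.
have : (lebesgue_measure (`[0%R, 1%R]%classic : set R) < 1%:E)%E.
  have mI : measurable (`[0%R, 1%R]%classic : set R) by [].
  have h := measure_sigma_subadditive (@lebesgue_measure R) mG mI cov.
  apply: le_lt_trans h _.
  apply: (@le_lt_trans _ _ (\sum_(0 <= i <oo) 2%:E * (d i `^ 1)%:E)%E).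
    by apply: lee_nneseries => i _ //; exact: Gd.
  rewrite nneseriesZl => [|i _]; last by rewrite lee_fin powR_ge0.
  apply: (@lt_le_trans _ _ (2%:E * (4^-1)%:E)%E).
    by rewrite lte_pmul2l ?lte_fin.
  by rewrite -EFinM lee_fin; lra.
by rewrite lebesgue_measure_itv /= lte_fin ltr01 oppr0 adde0 ltxx.
Qed.

Theorem hausdorff_dim_univoque :
  hausdorff_dim (univoque M q) = (entropy R U / log2 q)%:E.
Proof.
apply/eqP; rewrite eq_le; apply/andP; split.
  apply/lee_addgt0Pr => e e0; apply: ereal_inf_lbound.
  exists (entropy R U / log2 q + e) => //; split.
    by rewrite addr_ge0 ?(ltW e0)// divr_ge0 ?entropy_ge0 // ltW // log2_gt0.
  by apply: hausdorff_null_above; rewrite ltrDl.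
apply: le_ereal_inf_tmp => _ [s [s0 H0] <-]; rewrite lee_fin.
rewrite ler_pdivrMr ?log2_gt0 //.
have [A1|A1] := eqVneq A 1.
  have s1 := hausdorff_null_ge1 A1 s0 H0.
  (* There are at most [M + 1 = q] words of length 1, so the entropy is at most [log2 q]. *)
  apply: le_trans (entropy_le_word_growth stU U0 (leqnn 1)) _.
  apply: (@le_trans _ _ (log2 q)); last first.
    by rewrite ler_peMl // ltW // log2_gt0.
  rewrite /word_growth divr1 ler_pM2r ?invr_gt0 ?ln2_gt0//.
  rewrite ler_ln ?posrE// ?ltr0n ?card_initial_words_gt0//.
  rewrite (max_val_eq1 q_gt1 A1).
  by rewrite ler_nat (leq_trans (card_initial_words_le _ _)) // expn1.
rewrite -ler_pdivrMr ?log2_gt0 //; apply/ler_addgt0Pl => e e0.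
rewrite ler_pdivrMr ?log2_gt0 //.
by apply: entropy_le_of_hausdorff_null H0 => //; rewrite s0 ltrDr.
Qed.

End Dimension.

Theorem theorem1p3 (R : realType) (M : nat) (hM : (1 <= M)%N) (q : R)
    (hq : 1 < q) :
  [/\ cvgn (word_growth R (univoque_seq M q)),
      entropy R (univoque_seq M q) =
        inf [set word_growth R (univoque_seq M q) n | n in [set n | (1 <= n)%N]]
    & hausdorff_dim (univoque M q) =
        (entropy R (univoque_seq M q) / log2 q)%:E].
Proof.
have st : shift_stable (univoque_seq M q).
  by move=> n c; exact: univoque_seq_shift.
have ne := @univoque_seq_neq0 R M q hq.
have cv := @word_growth_cvg R M _ st ne.
split; first by apply: cvgP cv.
- exact: entropyE.
- exact: hausdorff_dim_univoque.
Qed.
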